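(* Consider the linear quadratic state-transfer problem under frequency constraints $$\min_{(u_t)_{t=0}^{T-1}}\ \sum_{t=0}^{T-1}\Big(\tfrac12\langle x_t,Qx_t\rangle+\tfrac12\langle u_t,Ru_t\rangle\Big)\quad\text{subject to}\quad\begin{cases}x_{t+1}=Ax_t+Bu_t,& t=0,\dots,T-1,\\ \sum_{t=0}^{T-1}F_tu_t=0,&\\ x_0=\bar x,\quad x_T=\hat x,&\end{cases}$$ with data as described in the context and with $\ell$ the number of rows of the matrices $F_t$ (the number of frequency constraints). (a) If the pair $(A,B)$ is controllable, $T\ge d$, and $\ell+d>mT$, then all the optimal state-action trajectories are abnormal. (b) Conversely, all the optimal state-action trajectories are normal when the reachability matrix $\begin{pmatrix}B& AB&\cdots&A^{T-1}B\end{pmatrix}\in\mathbb R^{d\times mT}$ and the frequency constraints matrix $\begin{pmatrix}F_0&F_1&\cdots&F_{T-1}\end{pmatrix}\in\mathbb R^{\ell\times mT}$ have independent rows (i.e. the $d+\ell$ rows of the two matrices taken together are linearly independent).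
   Context: Data: $T,d,m$ are positive integers; $A\in\mathbb R^{d\times d}$, $B\in\mathbb R^{d\times m}$; $Q\in\mathbb R^{d\times d}$ is positive semi-definite and $R\in\mathbb R^{m\times m}$ is positive definite (both symmetric); $\bar x,\hat x\in\mathbb R^d$. There are no control or intermediate state constraints. $(A,B)$ is controllable if $\mathrm{rank}\begin{pmatrix}B&AB&\cdots&A^{d-1}B\end{pmatrix}=d$. An optimal state-action trajectory is a feasible pair $((x_t^* )_{t=0}^T,(u_t^* )_{t=0}^{T-1})$ attaining the minimum. Frequency constraints: for $u=(u_0,\dots,u_{T-1})\in(\mathbb R^m)^T$ let $u^{(k)}\in\mathbb R^T$ ($k=1,\dots,m$) be the sequence of $k$-th components. Let $\Phi\in\mathbb C^{T\times T}$ be the DFT matrix with entries $\Phi_{\xi t}=T^{-1/2}e^{-2\pi i\xi t/T}$, $\xi,t=0,\dots,T-1$, and $\bar\Phi=\mathrm{blkdiag}(\Phi,\dots,\Phi)\in\mathbb C^{mT\times mT}$. For each $k$ a set $W^{(k)}\subset\{0,\dots,T-1\}$ of allowed frequencies is given; $D^{(k)}$ is the matrix formed by the rows $e_\xi$ of the identity $I_T$ with $\xi\notin W^{(k)}$, and $D=\mathrm{blkdiag}(D^{(1)},\dots,D^{(m)})$. Let $L\in\mathbb R^{mT\times mT}$ be the permutation matrix mapping the stacked vector $(u^{(1)},\dots,u^{(m)})$ to $(u_0,\dots,u_{T-1})$. Form $\begin{pmatrix}D\,\mathrm{Re}\,\bar\Phi\\ D\,\mathrm{Im}\,\bar\Phi\end{pmatrix}L^{-1}$,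 eliminate its zero rows if necessary, let $\ell$ be the resulting number of rows, and partition its columns as $[F_0\ F_1\ \cdots\ F_{T-1}]$ with $F_t\in\mathbb R^{\ell\times m}$; this is the frequency constraints matrix. Extremals: an extremal lift of an optimal state-action trajectory is a choice of $\eta^C\in\{0,1\}$, $\eta^u\in\mathbb R^\ell$ and $(\eta^f_t)_{t=0}^{T-1}\subset\mathbb R^d$, not all simultaneously zero, satisfying the Pontryagin maximum principle, which for this problem reads $$\eta^f_{t-1}=A^\top\eta^f_t-\eta^CQx^*_t\ \ (t=1,\dots,T-1),\qquad \eta^CRu^*_t=B^\top\eta^f_t-F_t^\top\eta^u\ \ (t=0,\dots,T-1)$$ (together with the dynamics, the frequency constraints and the boundary conditions on $x^*$; $\eta^f_0$ and $\eta^f_{T-1}$ are not constrained by boundary conditions). A lift with $\eta^C=1$ is called normal and a lift with $\eta^C=0$ is called abnormal. An optimal state-action trajectory is called abnormal if it admits an abnormal extremal lift, and normal if it admits no abnormal extremal lift (all its extremal lifts are normal). *)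

(* Defs.v *)
From mathcomp Require Export all_boot all_order all_algebra.
From mathcomp Require Export complex.
From mathcomp Require Export reals trigo.

Set Implicit Arguments.
Unset Strict Implicit.
Unset Printing Implicit Defensive.

Import Order.TTheory GRing.Theory Num.Theory.

Local Open Scope ring_scope.
Local Open Scope complex_scope.

Definition dotcV (R : realType) n (v w : 'cV[R]_n) : R := (v^T *m w) 0 0.

Definition possemidef (R : realType) n (M : 'M[R]_n) : Prop :=
  M^T = M /\ forall v : 'cV[R]_n, 0 <= dotcV v (M *m v).

Definition posdef (R : realType) n (M : 'M[R]_n) : Prop :=
  M^T = M /\ forall v : 'cV[R]_n, v != 0 -> 0 < dotcV v (M *m v).

Definition reach_mx (R : realType) d m (A : 'M[R]_d) (B : 'M[R]_(d, m))
    (n : nat) : 'M[R]_(d, \sum_(i < n) m) :=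
  \mxrow_(i < n) (A ^+ i *m B).

Definition controllable (R : realType) d m (A : 'M[R]_d) (B : 'M[R]_(d, m))
    : Prop :=
  \rank (reach_mx A B d) = d.

(* Stacked sequences of T vectors of size m come in
    two layouts: component-major, (u^(1), ..., u^(m)), of size \sum_(k < m) T,
    and time-major, (u_0, ..., u_(T-1)), of size \sum_(t < T) m. *)

Definition cis (R : realType) (a : R) : R[i] := cos a +i* sin a.

Definition dft_mx (R : realType) (T : nat) : 'M[R[i]]_T :=
  \matrix_(xi, t) ((Num.sqrt T%:R)^-1%:C
                   * cis (- (2%:R * pi * xi%:R * t%:R / T%:R))).

Definition dft_blkdiag (R : realType) (T m : nat) : 'M[R[i]]_(\sum_(k < m) T) :=
  \mxdiag_(k < m) dft_mx R T.

Definition forbid_mx (R : realType) (T : nat) (Wk : {set 'I_T})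
    : 'M[R]_(#|~: Wk|, T) :=
  rowsub (fun i => enum_val i) 1%:M.

(* [\mxdiag] only has square blocks, hence [\mxblock]. *)
Definition forbid_blkdiag (R : realType) (T m : nat) (W : 'I_m -> {set 'I_T})
    : 'M[R]_(\sum_(k < m) #|~: W k|, \sum_(k < m) T) :=
  \mxblock_(k < m, l < m) (if k == l then forbid_mx R (W k) else 0).

Lemma layoutE (T m : nat) : (\sum_(t < T) m = \sum_(k < m) T)%N.
Proof. by rewrite !sum_nat_const !card_ord mulnC. Qed.

(* The permutation matrix taking the component-major layout to the time-major
   one: the row of u_t's k-th entry has its 1 in the column of u^(k)'s t-th
   entry.  The cast makes it square. *)
Definition layout_mx (R : realType) (T m : nat) : 'M[R]_(\sum_(k < m) T) :=
  castmx (layoutE T m, erefl)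
    (\mxblock_(t < T, k < m) (delta_mx k t : 'M[R]_(m, T))).

Definition freq_full_mx (R : realType) (T m : nat) (W : 'I_m -> {set 'I_T})
    : 'M[R]_(\sum_(k < m) #|~: W k| + \sum_(k < m) #|~: W k|,
             \sum_(t < T) m) :=
  castmx (erefl, esym (layoutE T m))
    (col_mx (forbid_blkdiag R W *m map_mx (@complex.Re R) (dft_blkdiag R T m))
            (forbid_blkdiag R W *m map_mx (@complex.Im R) (dft_blkdiag R T m))
     *m invmx (layout_mx R T m)).

(* Every zero row of [freq_full_mx] (such as the imaginary row of frequency 0)
   is dropped; [freq_num] is the number of rows left. *)
Definition nonzero_rows (R : realType) p q (M : 'M[R]_(p, q)) : {set 'I_p} :=
  [set i | row i M != 0].

Definition freq_num (R : realType) (T m : nat) (W : 'I_m -> {set 'I_T}) : nat :=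
  #|nonzero_rows (freq_full_mx R W)|.

Definition freq_mx (R : realType) (T m : nat) (W : 'I_m -> {set 'I_T})
    : 'M[R]_(freq_num R W, \sum_(t < T) m) :=
  rowsub (fun i => enum_val i) (freq_full_mx R W).

Definition freq_block (R : realType) (T m : nat) (W : 'I_m -> {set 'I_T})
    (t : 'I_T) : 'M[R]_(freq_num R W, m) :=
  submxrow (freq_mx R W) t.

(* A state trajectory is x : 'I_T.+1 -> _; for
    t : 'I_T, x_t is [x (tcur t)] and x_(t+1) is [x (tnext t)]. *)

Definition tcur (T : nat) (t : 'I_T) : 'I_T.+1 := widen_ord (leqnSn T) t.
Definition tnext (T : nat) (t : 'I_T) : 'I_T.+1 := lift ord0 t.

Record feasible (R : realType) (T d m : nat) (A : 'M[R]_d) (B : 'M[R]_(d, m))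
    (W : 'I_m -> {set 'I_T}) (xbar xhat : 'cV[R]_d)
    (x : 'I_T.+1 -> 'cV[R]_d) (u : 'I_T -> 'cV[R]_m) : Prop := Feasible {
  feasible_dyn : forall t : 'I_T, x (tnext t) = A *m x (tcur t) + B *m u t;
  feasible_freq : \sum_(t < T) freq_block R W t *m u t = 0;
  feasible_init : x ord0 = xbar;
  feasible_final : x ord_max = xhat }.

Definition cost (R : realType) (T d m : nat) (Q : 'M[R]_d) (Ru : 'M[R]_m)
    (x : 'I_T.+1 -> 'cV[R]_d) (u : 'I_T -> 'cV[R]_m) : R :=
  \sum_(t < T) (2^-1 * dotcV (x (tcur t)) (Q *m x (tcur t))
                + 2^-1 * dotcV (u t) (Ru *m u t)).

Definition optimal (R : realType) (T d m : nat) (A : 'M[R]_d)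
    (B : 'M[R]_(d, m)) (Q : 'M[R]_d) (Ru : 'M[R]_m) (W : 'I_m -> {set 'I_T})
    (xbar xhat : 'cV[R]_d)
    (x : 'I_T.+1 -> 'cV[R]_d) (u : 'I_T -> 'cV[R]_m) : Prop :=
  feasible A B W xbar xhat x u /\
  forall (y : 'I_T.+1 -> 'cV[R]_d) (v : 'I_T -> 'cV[R]_m),
    feasible A B W xbar xhat y v -> cost Q Ru x u <= cost Q Ru y v.

Record extremal_lift (R : realType) (T d m : nat) (A : 'M[R]_d)
    (B : 'M[R]_(d, m)) (Q : 'M[R]_d) (Ru : 'M[R]_m) (W : 'I_m -> {set 'I_T})
    (xbar xhat : 'cV[R]_d)
    (x : 'I_T.+1 -> 'cV[R]_d) (u : 'I_T -> 'cV[R]_m)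
    (etaC : R) (etau : 'cV[R]_(freq_num R W)) (etaf : 'I_T -> 'cV[R]_d)
    : Prop := ExtremalLift {
  lift_feasible : feasible A B W xbar xhat x u;
  lift_etaC : etaC = 0 \/ etaC = 1;
  lift_nontrivial : ~ [/\ etaC = 0, etau = 0 & forall t, etaf t = 0];
  lift_adjoint : forall s t : 'I_T, t = s.+1 :> nat ->
    etaf s = A^T *m etaf t - etaC *: (Q *m x (tcur t));
  lift_max : forall t : 'I_T,
    etaC *: (Ru *m u t) = B^T *m etaf t - (freq_block R W t)^T *m etau }.

Definition abnormal_traj (R : realType) (T d m : nat) (A : 'M[R]_d)
    (B : 'M[R]_(d, m)) (Q : 'M[R]_d) (Ru : 'M[R]_m) (W : 'I_m -> {set 'I_T})
    (xbar xhat : 'cV[R]_d)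
    (x : 'I_T.+1 -> 'cV[R]_d) (u : 'I_T -> 'cV[R]_m) : Prop :=
  exists (etau : 'cV[R]_(freq_num R W)) (etaf : 'I_T -> 'cV[R]_d),
    extremal_lift A B Q Ru xbar xhat x u 0 etau etaf.

Definition normal_traj (R : realType) (T d m : nat) (A : 'M[R]_d)
    (B : 'M[R]_(d, m)) (Q : 'M[R]_d) (Ru : 'M[R]_m) (W : 'I_m -> {set 'I_T})
    (xbar xhat : 'cV[R]_d)
    (x : 'I_T.+1 -> 'cV[R]_d) (u : 'I_T -> 'cV[R]_m) : Prop :=
  ~ abnormal_traj A B Q Ru W xbar xhat x u.

(* Main.v *)
Require Import Defs.
From mathcomp Require Import ring.

(** In an abnormal lift the running cost disappears from the maximum principle:
    the costates obey the homogeneous recursion eta_(t-1) = A^T eta_t, so they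
    are determined by the last one, p, through eta_t = (A^T)^(T-1-t) p, and the
    maximality condition becomes p^T A^(T-1-t) B = etau^T F_t for all t.  This
    says that (p, - etau) is in the left kernel of the matrix stacking
    (A^(T-1)B ... AB B) on top of (F_0 ... F_(T-1)), and the lift is nontrivial
    exactly when that vector is nonzero.  Hence a feasible trajectory is
    abnormal iff these d + l rows are linearly dependent ([abnormal_trajP]).

    Part (a) follows at once: d + l rows of length m T are dependent when
    d + l > m T.

    Part (b) assumes instead the independence of the rows of F and of the
    reachability matrix (B AB ... A^(T-1)B), whose blocks come in the opposite
    time order.  The two orders are equivalent because the row space of F is
    invariant under the time reversal t |-> T-1-t ([freq_block_rev]): for an
    integer frequency xi, with phi = 2 pi xi / T, the angle phi (T-1-t) equals
    - phi - phi t up to a multiple of 2 pi, so the addition formulas express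
    the reversed cosine and sine rows of frequency xi as combinations of the
    cosine and sine rows of the same frequency xi ([dft_rev_Re],
    [dft_rev_Im]). *)

Set Implicit Arguments.
Unset Strict Implicit.
Unset Printing Implicit Defensive.

Import Order.TTheory GRing.Theory Num.Theory.

Local Open Scope ring_scope.

(** * The frequency constraints matrix, block by block *)

Section Matrices.

Variable R : realType.

Lemma map_mxdiag (S S' : nmodType) (f : S -> S') p n
    (V : 'I_p -> 'M[S]_n) : f 0 = 0 ->
  map_mx f (\mxdiag_(k < p) V k) = \mxdiag_(k < p) map_mx f (V k).
Proof.
move=> f0; apply/mxblockP => i j; rewrite mxblockK.
rewrite -[submxblock _ i j]map_mxsub -/(submxblock (mxdiag V) i j) mxblockK.
case: eqVneq => _; first by rewrite !conform_mx_id.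
by apply/matrixP => a b; rewrite !mxE.
Qed.

(** Lets a reindexing of time pass from the selector of the column of time t
    to the columns of the matrix it selects from. *)
Lemma mulmx_delta_colsub p n q r (f : 'I_n -> 'I_q) (X : 'M[R]_(p, q))
    (t : 'I_n) (k : 'I_r) :
  X *m delta_mx (f t) k = colsub f X *m delta_mx t k.
Proof.
apply/matrixP => i j; rewrite !mxE (bigD1 (f t)) // (bigD1 t) //=.
by rewrite !mxE !eqxx !big1 // => l /negPf lN; rewrite !mxE lN mulr0.
Qed.

(** The two casts undo each other, and the inverse of an orthogonal matrix is
    its transpose: this removes both from the definition of the frequency
    constraints matrix. *)
Lemma castmx_mul_invmx_orthogonal n n' p (e : n = n') (M : 'M[R]_(n, n'))
    (C : 'M[R]_(p, n')) : M *m M^T = 1%:M ->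
  castmx (erefl, esym e) (C *m invmx (castmx (e, erefl) M)) = C *m M^T.
Proof.
case: n' / e M C => M C MMT; rewrite !castmx_id; congr (_ *m _).
have [Mu _] := mulmx1_unit MMT.
by rewrite -[RHS]mul1mx -(mulVmx Mu) -mulmxA MMT mulmx1.
Qed.

Lemma layout_block_orthogonal T m :
  let M := \mxblock_(t < T, k < m) (delta_mx k t : 'M[R]_(m, T)) in
  M *m M^T = 1%:M.
Proof.
rewrite /= tr_mxblock mul_mxblock -mxdiagZ; apply/eq_mxblock => s t.
under eq_bigr do rewrite trmx_delta mul_delta_mx_cond.
case: eqVneq => _; first by rewrite conform_mx_id mx1_sum_delta.
by rewrite big1 // => k _; rewrite mulr0n.
Qed.

(** The columns, in the component-major layout, of the m entries of u_t. *)
Definition time_sel T m (t : 'I_T) : 'M[R]_(\sum_(k < m) T, m) :=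
  \mxcol_(k < m) delta_mx t k.

(** All the dependence on t sits in the selector: reversing time amounts to
    replacing [time_sel m t] by [time_sel m (rev_ord t)]. *)
Lemma submxrow_freq_full T m (W : 'I_m -> {set 'I_T}) (t : 'I_T) :
  submxrow (freq_full_mx R W) t =
  col_mx (forbid_blkdiag R W *m map_mx (@complex.Re R) (dft_blkdiag R T m))
         (forbid_blkdiag R W *m map_mx (@complex.Im R) (dft_blkdiag R T m))
  *m time_sel m t.
Proof.
rewrite /freq_full_mx /layout_mx castmx_mul_invmx_orthogonal; last first.
  exact: layout_block_orthogonal.
rewrite -mul_submxrow tr_mxblock submxrow_matrix; congr (_ *m _).
by apply/eq_mxcol => k; rewrite trmx_delta.
Qed.

(** * Time reversal of the frequency constraints *)

Definition dft_phase T (xi : 'I_T) : R := 2%:R * pi * xi%:R / T%:R.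

Lemma cosD2piXn (x : R) n : cos (x + 2%:R * pi * n%:R) = cos x.
Proof.
by rewrite -(periodicn (@cosD2pi R) n x); congr (cos (x + _)); ring.
Qed.

Lemma sinD2piXn (x : R) n : sin (x + 2%:R * pi * n%:R) = sin x.
Proof.
by rewrite -(periodicn (@sinD2pi R) n x); congr (sin (x + _)); ring.
Qed.

Lemma dft_mxRe T xi t : map_mx (@complex.Re R) (dft_mx R T) xi t =
  (Num.sqrt T%:R)^-1 * cos (dft_phase xi * t%:R).
Proof.
rewrite !mxE /= mul0r subr0 cosN; congr (_ * cos _).
by rewrite /dft_phase mulrAC.
Qed.

Lemma dft_mxIm T xi t : map_mx (@complex.Im R) (dft_mx R T) xi t =
  - ((Num.sqrt T%:R)^-1 * sin (dft_phase xi * t%:R)).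
Proof.
rewrite !mxE /= mul0r addr0 sinN mulrN; congr (- (_ * sin _)).
by rewrite /dft_phase mulrAC.
Qed.

(** The last term is a multiple of 2 pi since frequencies are integers; it
    disappears under cos and sin. *)
Lemma dft_phase_rev T (xi t : 'I_T) :
  dft_phase xi * (rev_ord t)%:R =
  - (dft_phase xi + dft_phase xi * t%:R) + 2%:R * pi * xi%:R.
Proof.
have T0 : T%:R != 0 :> R.
  by rewrite pnatr_eq0 -lt0n (leq_ltn_trans _ (ltn_ord t)).
rewrite /= natrB ?ltn_ord // /dft_phase.
rewrite mulrBr divfK // -natr1; ring.
Qed.

Definition phase_cos T : 'M[R]_T := diag_mx (\row_xi cos (dft_phase xi)).
Definition phase_sin T : 'M[R]_T := diag_mx (\row_xi sin (dft_phase xi)).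

(** Time reversal turns the sampled cosine of frequency xi into cos (phi +
    phi t), and the addition formula stays within frequency xi.  The plus sign
    comes from the imaginary part of the transform being - sin. *)
Lemma dft_rev_Re T :
  colsub (@rev_ord T) (map_mx (@complex.Re R) (dft_mx R T)) =
  phase_cos T *m map_mx (@complex.Re R) (dft_mx R T)
  + phase_sin T *m map_mx (@complex.Im R) (dft_mx R T).
Proof.
apply/matrixP => xi t; have := @dft_mxRe T; have := @dft_mxIm T.
move: (map_mx _ _) (map_mx _ _) => Y X YE XE.
rewrite /phase_cos /phase_sin !mul_diag_mx !mxE !XE !YE.
rewrite dft_phase_rev cosD2piXn cosN cosD; ring.
Qed.

Lemma dft_rev_Im T :
  colsub (@rev_ord T) (map_mx (@complex.Im R) (dft_mx R T)) =
  phase_sin T *m map_mx (@complex.Re R) (dft_mx R T)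
  - phase_cos T *m map_mx (@complex.Im R) (dft_mx R T).
Proof.
apply/matrixP => xi t; have := @dft_mxRe T; have := @dft_mxIm T.
move: (map_mx _ _) (map_mx _ _) => Y X YE XE.
rewrite /phase_cos /phase_sin !mul_diag_mx !mxE !XE !YE.
rewrite dft_phase_rev sinD2piXn sinN sinD; ring.
Qed.

(** Selecting the rows of the forbidden frequencies commutes with scaling each
    frequency, since reversal does not mix distinct frequencies. *)
Lemma forbid_mul_diag T m (W : 'I_m -> {set 'I_T}) (a : 'rV[R]_T) :
  forbid_blkdiag R W *m \mxdiag_(k < m) diag_mx a =
  \mxdiag_(k < m) diag_mx (colsub (fun i : 'I_#|~: W k| => enum_val i) a)
  *m forbid_blkdiag R W.
Proof.
rewrite mul_mxblock_mxdiag mul_mxdiag_mxblock; apply/eq_mxblock => k l.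
case: eqVneq => [->|_]; last by rewrite mul0mx mulmx0.
apply/matrixP => i j; rewrite mul_mx_diag mul_diag_mx !mxE.
by case: eqVneq => [->|_]; rewrite ?mulr1 ?mul1r // mulr0 mul0r.
Qed.

(** The phase rotations act on the real and imaginary rows of each forbidden
    frequency, so they combine into one matrix S acting on the left,
    independently of t. *)
Lemma freq_full_rev T m (W : 'I_m -> {set 'I_T}) :
  exists S, forall t, submxrow (freq_full_mx R W) (rev_ord t) =
                      S *m submxrow (freq_full_mx R W) t.
Proof.
pose sel k (i : 'I_#|~: W k|) : 'I_T := enum_val i.
pose DC := \mxdiag_(k < m)
  diag_mx (colsub (@sel k) (\row_xi cos (dft_phase xi))).
pose DS := \mxdiag_(k < m)
  diag_mx (colsub (@sel k) (\row_xi sin (dft_phase xi))).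
exists (block_mx DC DS DS (- DC)) => t; rewrite !submxrow_freq_full mulmxA.
rewrite mul_block_col !mul_col_mx /dft_blkdiag !map_mxdiag //.
set X := map_mx _ _; set Y := map_mx _ _; set F := forbid_blkdiag R W.
have HC : DC *m F = F *m \mxdiag_(k < m) phase_cos T by rewrite forbid_mul_diag.
have HS : DS *m F = F *m \mxdiag_(k < m) phase_sin T by rewrite forbid_mul_diag.
rewrite mulNmx !(mulmxA _ F) HC HS -!mulmxA -mulmxDr -mulmxBr -!mulmxA.
rewrite mulmxDl mulmxBl -!mulmxA /time_sel !mul_mxdiag_mxcol.
rewrite -mxcolD -mxcolB.
apply: f_equal2; apply: (f_equal (mulmx F)); apply/eq_mxcol => k;
  rewrite mulmx_delta_colsub.
  by rewrite dft_rev_Re mulmxDl !mulmxA.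
by rewrite dft_rev_Im mulmxBl !mulmxA.
Qed.

(** Dropping zero rows does not change the row space. *)
Lemma freq_full_sub T m (W : 'I_m -> {set 'I_T}) :
  (freq_full_mx R W <= freq_mx R W)%MS.
Proof.
apply/row_subP => i; have [->|nz] := eqVneq (row i (freq_full_mx R W)) 0.
  exact: sub0mx.
have iP : i \in nonzero_rows (freq_full_mx R W) by rewrite inE.
rewrite -(enum_rankK_in iP iP) -row_rowsub; exact: row_sub.
Qed.

(** The row space of the frequency constraints matrix is stable under time
    reversal: v F with its blocks reversed is some w F. *)
Lemma freq_block_rev T m (W : 'I_m -> {set 'I_T})
    (v : 'rV[R]_(freq_num R W)) :
  exists w, forall t,
    v *m freq_block R W (rev_ord t) = w *m freq_block R W t.
Proof.
have [S HS] := freq_full_rev W.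
have /submxP[P HP] : (freq_mx R W <= freq_full_mx R W)%MS.
  exact: rowsub_sub.
have /submxP[P' HP'] := freq_full_sub W.
exists (v *m P *m S *m P') => t; rewrite /freq_block !mul_submxrow.
by rewrite {1}HP -!mulmxA -HP' -!mul_submxrow HS.
Qed.

End Matrices.

(** * Abnormal lifts and the costate matrix *)

Lemma mul_row_col_mxrow_eq0 (R : realType) T d l m (P_ : 'I_T -> 'M[R]_(d, m))
    (F : 'M[R]_(l, \sum_(t < T) m)) p q :
  row_mx p q *m col_mx (\mxrow_t P_ t) F = 0 <->
  forall t, p *m P_ t + q *m submxrow F t = 0 :> 'rV_m.
Proof.
rewrite mul_row_col; split=> [H t|H].
  by rewrite -(mxrowK P_ t) !mul_submxrow -submxrowD H submxrow0.
apply/mxrowP => t; rewrite submxrow0 submxrowD -!mul_submxrow mxrowK; exact: H.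
Qed.

(** The matrix (A^(T-1)B ... AB B): the reachability matrix with its blocks in
    the order in which the controls act on the final state. *)
Definition costate_mx (R : realType) d m (A : 'M[R]_d) (B : 'M[R]_(d, m)) T
    : 'M[R]_(d, \sum_(t < T) m) :=
  \mxrow_(t < T) (A ^+ rev_ord t *m B).

(** Downward induction from the final time, written for row vectors. *)
Lemma adjoint_closed_form (R : realType) T d (A : 'M[R]_d)
    (p : 'I_T.+1 -> 'cV[R]_d) :
  (forall s t : 'I_T.+1, t = s.+1 :> nat -> p s = A^T *m p t) ->
  forall t, (p t)^T = (p ord_max)^T *m A ^+ rev_ord t.
Proof.
move=> adj t; have [n] := ubnP (T - t)%N; elim: n t => // n IHn t le_n.
have [tT|tT] := eqVneq t ord_max.
  by rewrite tT /= subnn expr0 mulmx1.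
have ltT : (t < T)%N by rewrite ltn_neqAle -ltnS ltn_ord andbT.
pose t' : 'I_T.+1 := Ordinal (ltT : (t.+1 < T.+1)%N).
rewrite (adj t t') // trmx_mul trmxK (IHn t'); last first.
  by move: le_n; rewrite -(subnSK ltT) ltnS.
by rewrite /= -mulmxA !subSS -(subnSK ltT) exprSr.
Qed.

(** A left kernel vector of the stacked matrix is the last costate together
    with - etau.  The abnormality of a feasible trajectory thus depends neither
    on the trajectory nor on the cost. *)
Lemma abnormal_trajP (R : realType) T d m (A : 'M[R]_d) (B : 'M[R]_(d, m))
    (Q : 'M[R]_d) (Ru : 'M[R]_m) (W : 'I_m -> {set 'I_T}) xbar xhat x u :
  (0 < T)%N -> feasible A B W xbar xhat x u ->
  abnormal_traj A B Q Ru W xbar xhat x u <->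
  ~~ row_free (col_mx (costate_mx A B T) (freq_mx R W)).
Proof.
case: T => // T in W x u * => _ feas; split.
  case=> etau [etaf [_ _ nt adj max]].
  have {}adj (s t : 'I_T.+1) : t = s.+1 :> nat -> etaf s = A^T *m etaf t.
    by move=> /adj ->; rewrite scale0r subr0.
  have etafE := adjoint_closed_form adj.
  apply/negP => free; apply: nt.
  have : row_mx (etaf ord_max)^T (- etau^T)
           *m col_mx (costate_mx A B T.+1) (freq_mx R W) = 0.
    apply/mul_row_col_mxrow_eq0 => t; rewrite mulmxA -etafE mulNmx.
    rewrite -[B]trmxK -[submxrow _ _]trmxK -!trmx_mul -linearB /=.
    by rewrite -(max t) scale0r trmx0.
  move=> /eqP; rewrite mulmx_free_eq0 // row_mx_eq0 oppr_eq0.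
  rewrite !trmx_eq0 => /andP[/eqP p0 /eqP q0]; split=> // t.
  by apply: trmx_inj; rewrite etafE p0 trmx0 mul0mx.
move=> /negP nfree.
have /rowV0Pn[v /sub_kermxP vM vN0] :
    kermx (col_mx (costate_mx A B T.+1) (freq_mx R W)) != 0.
  by apply/negP; rewrite kermx_eq0 => /nfree.
move: vM vN0; rewrite -(hsubmxK v); set p := lsubmx v; set q := rsubmx v.
rewrite /costate_mx => /mul_row_col_mxrow_eq0 H vN0.
exists (- q^T), (fun t => (p *m A ^+ rev_ord t)^T); split=> //; first by left.
(* The last costate is p itself, so p and q cannot both vanish. *)
- case=> _ /eqP; rewrite oppr_eq0 => /eqP q0 /(_ ord_max).
  rewrite /= subnn expr0 mulmx1 => p0; case/negP: vN0.
  by rewrite -(trmxK p) p0 -(trmxK q) q0 !trmx0 row_mx0.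
- move=> s t ts; rewrite scale0r subr0 -trmx_mul -mulmxA -[_ *m A]exprSr /=.
  by rewrite ts subnSK // -ts ltn_ord.
move=> t; rewrite scale0r mulmxN opprK -!trmx_mul -mulmxA -linearD /=.
by rewrite H trmx0.
Qed.

(** Take a relation (p, q) for the costate order.  Reversing time turns
    it into a relation (p, w) for the reachability matrix, with w from
    [freq_block_rev]; hence p = 0, and then (0, q) is itself a relation for the
    reachability matrix. *)
Lemma row_free_costate (R : realType) T d m (A : 'M[R]_d) (B : 'M[R]_(d, m))
    (W : 'I_m -> {set 'I_T}) :
  row_free (col_mx (reach_mx A B T) (freq_mx R W)) ->
  row_free (col_mx (costate_mx A B T) (freq_mx R W)).
Proof.
move=> free; apply: inj_row_free => v.
rewrite -(hsubmxK v); set p := lsubmx v; set q := rsubmx v.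
rewrite /costate_mx => /mul_row_col_mxrow_eq0 H.
have ker (p' : 'rV_d) q' : (forall t : 'I_T,
    p' *m (A ^+ t *m B) + q' *m freq_block R W t = 0) -> p' = 0 /\ q' = 0.
  move=> /mul_row_col_mxrow_eq0/eqP; rewrite mulmx_free_eq0 // row_mx_eq0.
  by case/andP=> /eqP-> /eqP->.
have [w Hw] := freq_block_rev q.
have [p0 _] : p = 0 /\ w = 0.
  by apply: ker => t; rewrite -Hw; have := H (rev_ord t); rewrite rev_ordK.
have [_ q0] : 0 = 0 :> 'rV[R]_d /\ q = 0.
  by apply: ker => t; have := H t; rewrite p0 !mul0mx.
by rewrite p0 q0 row_mx0.
Qed.

Theorem propositionp (R : realType) (T d m : nat)
    (T_gt0 : (0 < T)%N) (d_gt0 : (0 < d)%N) (m_gt0 : (0 < m)%N)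
    (A : 'M[R]_d) (B : 'M[R]_(d, m)) (Q : 'M[R]_d) (Ru : 'M[R]_m)
    (Q_psd : possemidef Q) (Ru_pd : posdef Ru)
    (xbar xhat : 'cV[R]_d) (W : 'I_m -> {set 'I_T}) :
  (controllable A B -> (d <= T)%N -> (m * T < freq_num R W + d)%N ->
     forall (x : 'I_T.+1 -> 'cV[R]_d) (u : 'I_T -> 'cV[R]_m),
       optimal A B Q Ru W xbar xhat x u ->
       abnormal_traj A B Q Ru W xbar xhat x u)
  /\
  (row_free (col_mx (reach_mx A B T) (freq_mx R W)) ->
     forall (x : 'I_T.+1 -> 'cV[R]_d) (u : 'I_T -> 'cV[R]_m),
       optimal A B Q Ru W xbar xhat x u ->
       normal_traj A B Q Ru W xbar xhat x u).
Proof.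
split=> [_ _ many x u [feas _]|free x u [feas _]].
  apply/(abnormal_trajP Q Ru T_gt0 feas); rewrite /row_free neq_ltn.
  apply/orP; left; apply: leq_ltn_trans (rank_leq_col _) _.
  by rewrite sum_nat_const card_ord mulnC [X in (_ < X)%N]addnC.
move=> /(abnormal_trajP Q Ru T_gt0 feas) /negP; apply.
exact: row_free_costate.
Qed.
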